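(* Let $q$ be a prime power and $n\ge 1$ an integer. The number of unipotent elements of $U(n,q)$ is $q^{n(n-1)}$.
   Context: $U(n,q)\subset GL(n,q^2)$ is the finite unitary group, i.e. the group of invertible $n\times n$ matrices over the field $F_{q^2}$ with $q^2$ elements preserving a nondegenerate Hermitian form on $F_{q^2}^n$ (Hermitian with respect to the automorphism $a\mapsto a^q$). An element is called unipotent if all of its eigenvalues (in an algebraic closure of $F_{q^2}$) are equal to $1$. *)

(* Defs.v *)
(* MathComp *)
From mathcomp Require Import all_boot all_order all_algebra all_field.
From mathcomp Require Import boolp.

Set Implicit Arguments.
Unset Strict Implicit.
Unset Printing Implicit Defensive.

Import GRing.Theory.
Local Open Scope ring_scope.

Definition prime_power (q : nat) : Prop :=
  exists p e : nat, [/\ prime p, (0 < e)%N & q = (p ^ e)%N].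

(* Matrices act on row vectors from the right, as in [eigenvalue]. *)
Definition unitary_group (F : finFieldType) (theta : {rmorphism F -> F})
    (n : nat) (h : {hermitian 'rV[F]_n for false & theta}) : {set 'M[F]_n} :=
  [set A in unitmx | `[< isometry h h (mulmxr A) >]].

(* [iota] is meant to embed [F] into an algebraic closure [K]. *)
Definition unipotent (F : fieldType) (K : closedFieldType)
    (iota : {rmorphism F -> K}) (n : nat) (A : 'M[F]_n) : Prop :=
  forall a : K, eigenvalue (map_mx iota A) a -> a = 1.

(* Main.v *)
Require Import Defs.
From mathcomp Require Import all_boot all_order all_algebra all_field.
From mathcomp Require Import boolp.
From mathcomp Require Import ring lra zify.

Set Implicit Arguments.
Unset Strict Implicit.
Unset Printing Implicit Defensive.

Import GRing.Theory Num.Theory.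
Local Open Scope ring_scope.

(** A Cayley transform identifies the unipotent elements of the unitary group
with the nilpotent self-adjoint matrices. By Fitting's lemma, a self-adjoint
matrix splits orthogonally and uniquely into a nilpotent and an invertible one,
so that, writing [u n], [s n] and [a n] for the numbers of unitary, nilpotent
self-adjoint and invertible self-adjoint matrices of size [n],
[q ^ (n ^ 2) / u n = \sum_(k <= n) (s k / u k) * (a (n - k) / u (n - k))].
Since all nondegenerate Hermitian forms are equivalent, [a n * u n = #|GL_n|],
and [u n] is computed by counting unit vectors. With [t = - q], replacing
[s k] by [q ^ (k * (k - 1))] in the right-hand side gives the same value,
because both sides then satisfy the recursion
[(t ^ n - 1) * c n = t ^ n * c (n - 1)]; induction on [n] concludes. *)

(** * Fibre counting and orders of general linear groups *)

Lemma card_fibers (T T' : finType) (f : T -> T') (D : {set T}) (E : {set T'})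
    (c : nat) :
  {in D, forall x, f x \in E} ->
  {in E, forall y, #|[set x in D | f x == y]| = c} -> #|D| = (#|E| * c)%N.
Proof.
move=> fDE fib; rewrite -sum1_card (partition_big f (mem E)) //=.
rewrite -sum_nat_const; apply: eq_bigr => y Ey.
by rewrite -(fib y Ey) -sum1_card; apply: eq_bigl => x; rewrite inE.
Qed.

Lemma card_unitmx0 (F : finFieldType) : #|[set A : 'M[F]_0 | A \in unitmx]| = 1%N.
Proof.
apply/eqP/cards1P; exists 1%:M; apply/setP => A.
by rewrite !inE [A]flatmx0 [1%:M]flatmx0 eqxx unitmxE det_mx00 unitr1.
Qed.

(** ['GL_n[F]] consists of matrices of size [n.-1.+1], so size [0] has to be counted apart. *)
Lemma card_unitmxE (F : finFieldType) n : (0 < n)%N ->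
  #|[set A : 'M[F]_n | A \in unitmx]| = #|'GL_n[F]%g|.
Proof.
case: n => // n _; rewrite -[RHS](card_imset _ val_inj).
apply: eq_card => A; rewrite !inE; apply/idP/imsetP => [uA|[u _ ->]].
  by exists (Sub A uA : {'GL_n.+1[F]}); rewrite ?inE ?SubK.
exact: (valP u).
Qed.

Lemma card_unitmxS (F : finFieldType) n :
  #|[set A : 'M[F]_n.+1 | A \in unitmx]| =
  (#|F| ^ n * (#|F| ^ n.+1 - 1) * #|[set A : 'M[F]_n | A \in unitmx]|)%N.
Proof.
rewrite card_unitmxE // card_GL //.
case: n => [|n]; first by rewrite card_unitmx0 big_nat1 bin_small // !muln1.
rewrite card_unitmxE // card_GL // big_nat_recr //= binS bin1 expnD.
ring.
Qed.

(** * Idempotent powers and nilpotency *)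

Section Idempotent.
Variable (F : finFieldType).

(** If there are [c] matrices, the powers of each of them have preperiod and period at most [c]; the
    factorial of [c] bounds the first and is a multiple of the second. This one exponent therefore
    makes every matrix idempotent. *)
Definition idem_exp n := #|{: 'M[F]_n}|`!.

Lemma idem_expP n (A : 'M[F]_n) : A ^+ idem_exp n * A ^+ idem_exp n = A ^+ idem_exp n.
Proof.
set N := idem_exp n; set c := #|{: 'M[F]_n}|.
have /injectivePn [i [j neq_ij eq_ij]] :
    ~~ injectiveb (fun i : 'I_c.+1 => A ^+ i).
  by apply/injectiveP => /leq_card; rewrite card_ord ltnn.
wlog lt_ij : i j neq_ij eq_ij / (i < j)%N.
  move=> IH; case: (ltngtP i j) => [lt|lt|/val_inj eq]; first exact: (IH i j).
    by apply: (IH j i) => //; rewrite eq_sym.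
  by rewrite eq eqxx in neq_ij.
pose p := (j - i)%N; have p_gt0 : (0 < p)%N by rewrite subn_gt0.
have step1 k : (i <= k)%N -> A ^+ (k + p) = A ^+ k.
  move=> le_ik; rewrite -(subnK le_ik) -addnA subnKC ?(ltnW lt_ij) //.
  by rewrite !exprD eq_ij.
have step s k : (i <= k)%N -> A ^+ (k + s * p) = A ^+ k.
  move=> le_ik; elim: s => [|s IHs]; first by rewrite addn0.
  by rewrite mulSn addnCA addnC step1 // (leq_trans le_ik) ?leq_addr.
have le_pc : (p <= c)%N by rewrite (leq_trans (leq_subr _ _)) // -ltnS.
have /dvdnP [s defN] : (p %| N)%N by rewrite dvdn_fact // p_gt0.
have le_iN : (i <= N)%N.
  by rewrite (leq_trans _ (fact_geq c)) // -ltnS (leq_trans lt_ij) // ltnW.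
by rewrite -exprD {2}defN step.
Qed.
End Idempotent.

(** The idempotent power equals all its own positive powers, hence has any vanishing [A ^+ k] as a
    factor. *)
Lemma nilpotentP (F : finFieldType) n (A : 'M[F]_n) :
  reflect (exists k, A ^+ k = 0) (A ^+ idem_exp F n == 0).
Proof.
apply: (iffP eqP) => [|[k Ak0]]; first by exists (idem_exp F n).
have E j : A ^+ idem_exp F n = A ^+ idem_exp F n ^+ j.+1.
  by elim: j => [|j IHj]; rewrite ?expr1 // exprS -IHj idem_expP.
by rewrite (E k) -exprM mulnC exprM exprS Ak0 mulr0 expr0n eqn0Ngt fact_gt0.
Qed.

(** * Adjoints of matrices *)

Section Star.
Variables (F : finFieldType) (theta : {rmorphism F -> F}).

Definition star m n (A : 'M[F]_(m, n)) : 'M[F]_(n, m) := map_mx theta A^T.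

Lemma starM m n p (A : 'M_(m, n)) (B : 'M_(n, p)) :
  star (A *m B) = star B *m star A.
Proof. by rewrite /star trmx_mul map_mxM. Qed.
Lemma starD m n (A B : 'M_(m, n)) : star (A + B) = star A + star B.
Proof. by rewrite /star linearD map_mxD. Qed.
Lemma starN m n (A : 'M_(m, n)) : star (- A) = - star A.
Proof. by rewrite /star linearN map_mxN. Qed.
Lemma starB m n (A B : 'M_(m, n)) : star (A - B) = star A - star B.
Proof. by rewrite starD starN. Qed.
Lemma starZ m n a (A : 'M_(m, n)) : star (a *: A) = theta a *: star A.
Proof. by rewrite /star linearZ map_mxZ. Qed.
Lemma star0 m n : star (0 : 'M_(m, n)) = 0.
Proof. by rewrite /star trmx0 map_mx0. Qed.
Lemma star1 n : star (1%:M : 'M_n) = 1%:M.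
Proof. by rewrite /star trmx1 map_mx1. Qed.
Lemma starX n (A : 'M_n) k : star (A ^+ k) = star A ^+ k.
Proof.
elim: k => [|k IHk]; first exact: star1.
by rewrite exprS starM IHk exprSr.
Qed.
Lemma star_col m1 m2 n (A : 'M_(m1, n)) (B : 'M_(m2, n)) :
  star (col_mx A B) = row_mx (star A) (star B).
Proof. by rewrite /star tr_col_mx map_row_mx. Qed.
Lemma star_row m n1 n2 (A : 'M_(m, n1)) (B : 'M_(m, n2)) :
  star (row_mx A B) = col_mx (star A) (star B).
Proof. by rewrite /star tr_row_mx map_col_mx. Qed.
Lemma star_block m1 m2 n1 n2 (A : 'M_(m1, n1)) (B : 'M_(m1, n2))
    (C : 'M_(m2, n1)) (D : 'M_(m2, n2)) :
  star (block_mx A B C D) = block_mx (star A) (star C) (star B) (star D).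
Proof. by rewrite /star tr_block_mx map_block_mx. Qed.
Lemma star_unitmx n (A : 'M_n) : (star A \in unitmx) = (A \in unitmx).
Proof. by rewrite map_unitmx unitmx_tr. Qed.
Lemma star_inv n (A : 'M_n) : star (invmx A) = invmx (star A).
Proof. by rewrite /star trmx_inv map_invmx. Qed.

Definition unitary n := [set A : 'M_n | A *m star A == 1%:M].
Definition selfadj n := [set A : 'M_n | star A == A].
Definition selfadj_unit n := [set A in selfadj n | A \in unitmx].
Definition selfadj_nil n := [set A in selfadj n | A ^+ idem_exp F n == 0].
Definition unit_vectors n := [set v : 'rV_n | v *m star v == 1%:M].

Lemma unitaryP n (A : 'M_n) : reflect (A *m star A = 1%:M) (A \in unitary n).
Proof. by rewrite inE; apply: eqP. Qed.
Lemma selfadjP n (A : 'M_n) : reflect (star A = A) (A \in selfadj n).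
Proof. by rewrite inE; apply: eqP. Qed.

Lemma unitary_unitmx n A : A \in unitary n -> A \in unitmx.
Proof. by move/unitaryP/mulmx1_unit => []. Qed.
Lemma unitaryK n A : A \in unitary n -> star A *m A = 1%:M.
Proof. by move/unitaryP/mulmx1C. Qed.
Lemma unitary1 n : 1%:M \in unitary n.
Proof. by apply/unitaryP; rewrite star1 mulmx1. Qed.
Lemma unitaryM n A B : A \in unitary n -> B \in unitary n -> A *m B \in unitary n.
Proof.
move=> /unitaryP uA /unitaryP uB; apply/unitaryP.
by rewrite starM mulmxA -(mulmxA A) uB mulmx1.
Qed.

Hypothesis theta_inv : involutive theta.

Lemma starK m n : cancel (@star m n) (@star n m).
Proof. by move=> A; apply/matrixP => i j; rewrite !mxE theta_inv. Qed.
Lemma unitary_star n A : A \in unitary n -> star A \in unitary n.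
Proof. by move=> uA; apply/unitaryP; rewrite starK unitaryK. Qed.
Lemma selfadj_congr n p (A : 'M_(p, n)) H :
  H \in selfadj n -> A *m H *m star A \in selfadj p.
Proof.
by move=> /selfadjP sH; apply/selfadjP; rewrite !starM starK sH mulmxA.
Qed.
Lemma selfadj_mulstar n p (A : 'M_(p, n)) : A *m star A \in selfadj p.
Proof. by apply/selfadjP; rewrite starM starK. Qed.

(* A matrix splits uniquely as a self-adjoint plus [l] times a self-adjoint. *)
Lemma card_selfadj l n : theta l != l ->
  (#|selfadj n| ^ 2 = #|F| ^ (n ^ 2))%N.
Proof.
move=> nl; have nl0 : l - theta l != 0 by rewrite subr_eq0 eq_sym.
have -> : (#|F| ^ (n ^ 2) = #|{: 'M[F]_n}|)%N by rewrite card_mx mulnn.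
rewrite -mulnn -cardsX.
pose f (x : 'M[F]_n * 'M[F]_n) := x.1 + l *: x.2.
have f_inj : {in setX (selfadj n) (selfadj n) &, injective f}.
  move=> [A B] [A' B'] /setXP [/selfadjP sA /selfadjP sB].
  move=> /setXP [/selfadjP sA' /selfadjP sB']; rewrite /f /= => e.
  have eB : B = B'.
    have e' : A + theta l *: B = A' + theta l *: B'.
      by have := congr1 (@star n n) e; rewrite !starD !starZ sA sB sA' sB'.
    apply: (scalerI nl0); rewrite !scalerBl.
    by rewrite -[LHS](addrKA A) e' [_ + A]addrC e [A' + l *: _]addrC addrKA.
  by move: e; rewrite eB => /addIr ->.
rewrite -(card_in_imset f_inj); apply: eq_card => M; rewrite !inE.
(* The equations [M = A + l *: B] and [star M = A + theta l *: B] determine [B]. *)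
apply/imsetP; pose B := (l - theta l)^-1 *: (M - star M).
have sB : star B = B.
  rewrite /B starZ fmorphV rmorphB theta_inv starB starK.
  by rewrite -[M - _]opprB -[l - _]opprB invrN scalerN scaleNr opprK.
exists (M - l *: B, B); last by rewrite /f /= subrK.
rewrite !inE sB eqxx andbT; apply/eqP.
rewrite starB starZ sB; apply/eqP.
have e : l *: B - theta l *: B = M - star M.
  by rewrite -scalerBl scalerA divff // scale1r.
have -> : star M = M - (l *: B - theta l *: B) by rewrite e subKr.
by rewrite opprB addrA addrAC addrK.
Qed.
End Star.

(* [(t ^ n - 1) = t ^ k * (t ^ (n - k) - 1) + (t ^ k - 1)] splits the convolution
   into two sums that telescope. *)
Lemma convolution_rec (R : fieldType) (t : R) (al be : nat -> R) n :
  (forall k, (t ^+ k.+1 - 1) * al k.+1 = - t ^+ k * al k) ->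
  (forall m, (t ^+ m.+1 - 1) * be m.+1 = (t ^+ m.+1 + 1) * be m) ->
  (t ^+ n.+1 - 1) * (\sum_(k < n.+2) al k * be (n.+1 - k)%N) =
  t ^+ n.+1 * (\sum_(k < n.+1) al k * be (n - k)%N).
Proof.
move=> al_rec be_rec.
pose A (k : nat) := t ^+ k * al k * ((t ^+ (n.+1 - k) - 1) * be (n.+1 - k)%N).
pose B (k : nat) := (t ^+ k - 1) * al k * be (n.+1 - k)%N.
have -> : (t ^+ n.+1 - 1) * (\sum_(k < n.+2) al k * be (n.+1 - k)%N) =
    \sum_(k < n.+2) A k + \sum_(k < n.+2) B k.
  rewrite mulr_sumr -big_split; apply: eq_bigr => k _ /=.
  have le_kn : (k <= n.+1)%N by rewrite -ltnS.
  rewrite /A /B -{1}(subnKC le_kn) exprD; ring.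
rewrite big_ord_recr [\sum_(k < n.+2) B k]big_ord_recl /=.
have -> : A n.+1 = 0 by rewrite /A subnn expr0 subrr mul0r mulr0.
have -> : B 0%N = 0 by rewrite /B expr0 subrr !mul0r.
rewrite addr0 add0r -big_split mulr_sumr; apply: eq_bigr => k _ /=.
have le_kn : (k <= n)%N by rewrite -ltnS.
(* [A k] and [B k.+1] are now paired: both are multiples of [al k * be (n - k)], with coefficients
   [t ^ k * (t ^ (n - k + 1) + 1)] and [- t ^ k], whose sum is [t ^ (n + 1)]. *)
rewrite /A /B /bump /= add1n al_rec subSS subSn // be_rec.
have -> : t ^+ n.+1 = t ^+ k * t ^+ (n - k).+1 by rewrite -exprD addnS subnKC.
ring.
Qed.

(** * Nilpotent and unipotent matrices *)

Lemma comm_mx_inv n (R : comUnitRingType) (A B : 'M[R]_n) : A *m B = B *m A ->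
  A *m invmx B = invmx B *m A.
Proof.
move=> AB; have [uB|nuB] := boolP (B \in unitmx); last by rewrite /invmx (negPf nuB).
by rewrite -[LHS](mulKmx uB) [B *m _]mulmxA -AB mulmxK.
Qed.

Lemma exprmxM n (R : pzRingType) (A B : 'M[R]_n) k : A *m B = B *m A ->
  (A *m B) ^+ k = A ^+ k *m B ^+ k.
Proof. by move=> AB; rewrite exprMn_comm. Qed.

(** A geometric sum inverts [B - 1%:M] for the nilpotent [B = - (b / a) A]. *)
Lemma nilpotent_unitmx n (F : fieldType) (a b : F) (A : 'M[F]_n) k :
  a != 0 -> A ^+ k = 0 -> a%:M + b *: A \in unitmx.
Proof.
move=> nz_a Ak0; pose B := (- b / a)%:M *m A.
have Bk0 : B ^+ k = 0 by rewrite exprmxM ?scalar_mxC // Ak0 mulmx0.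
have -> : a%:M + b *: A = (- a)%:M *m (B - 1%:M).
  rewrite mulmxBr mulmx1 mulmxA -scalar_mxM mul_scalar_mx raddfN opprK addrC.
  by congr (_ *: _ + _); field.
rewrite unitmx_mul unitmxE det_scalar unitrX ?unitfE ?oppr_eq0 //=.
have := subrX1 B k; rewrite Bk0 sub0r => /(congr1 -%R); rewrite opprK -mulrN => e.
by have [] := mulmx1_unit (esym e).
Qed.

(** If [A - 1%:M] is nilpotent, so is [a - 1] for every eigenvalue [a]. Conversely, if all
    eigenvalues are [1], the characteristic polynomial splits over [K] as a power of ['X - 1]; this
    already holds over [F], and Cayley-Hamilton applies. *)
Lemma unipotentP n (F : finFieldType) (K : closedFieldType)
    (iota : {rmorphism F -> K}) (A : 'M[F]_n) : (0 < n)%N ->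
  reflect (unipotent iota A) ((A - 1%:M) ^+ idem_exp F n == 0).
Proof.
case: n A => // n A _; apply: (iffP (nilpotentP _)) => [[k Ak0] a|uniA].
  case/eigenvalueP => v vA nz_v.
  have vAj j : v *m map_mx iota ((A - 1%:M) ^+ j) = (a - 1) ^+ j *: v.
    elim: j => [|j IHj]; first by rewrite !expr0 map_mx1 mulmx1 scale1r.
    rewrite exprSr map_mxM mulmxA IHj map_mxB map_mx1 -scalemxAl mulmxBr vA mulmx1.
    by rewrite exprSr -scalerA scalerBl scale1r.
  have /eqP := vAj k; rewrite Ak0 map_mx0 mulmx0 eq_sym scaler_eq0 (negPf nz_v) orbF.
  by rewrite expf_eq0 subr_eq0 => /andP [_ /eqP].
have [r def_p] := closed_field_poly_normal (char_poly (map_mx iota A)).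
rewrite (monicP (char_poly_monic _)) scale1r in def_p.
exists (size r).
have : map_poly iota (char_poly A) = map_poly iota (('X - 1%:P) ^+ size r).
  rewrite map_char_poly def_p rmorphXn /= rmorphB /= map_polyX map_polyC /= rmorph1.
  have r1 : r = nseq (size r) 1.
    apply/all_pred1P/allP => z rz; apply/eqP/uniA.
    by rewrite eigenvalue_root_char def_p root_prod_XsubC.
  by rewrite r1 big_nseq size_nseq -Monoid.iteropE.
move/map_poly_inj => char_A.
have := Cayley_Hamilton A; rewrite char_A rmorphXn rmorphB /=.
by rewrite horner_mx_X horner_mx_C.
Qed.

(** * Equivalence of Hermitian forms *)

Section HermitianForms.
Variables (q : nat) (F : finFieldType) (theta : {rmorphism F -> F}).
Hypothesis cardF : #|F| = (q ^ 2)%N.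
Hypothesis thetaE : forall a, theta a = a ^+ q.

Local Notation star := (star theta).
Local Notation unitary := (unitary theta).
Local Notation selfadj := (selfadj theta).
Local Notation selfadj_unit := (selfadj_unit theta).
Local Notation selfadj_nil := (selfadj_nil theta).
Local Notation unit_vectors := (unit_vectors theta).

Lemma q_gt1 : (1 < q)%N.
Proof.
by have := finNzRing_gt1 F; rewrite cardF; case: (q) => [|[]].
Qed.
Local Hint Resolve q_gt1 : core.

Lemma theta_inv : involutive theta.
Proof. by move=> a; rewrite !thetaE -exprM -[in RHS](expf_card a) cardF mulnn. Qed.
Local Hint Resolve theta_inv : core.

Lemma card_roots_leq (p : {poly F}) (D : {set F}) :
  p != 0 -> {in D, forall x, root p x} -> (#|D| < size p)%N.
Proof.
move=> nz_p rD; rewrite cardE; apply: max_poly_roots => //.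
  by apply/allP => x; rewrite mem_enum => /rD.
by rewrite enum_uniq.
Qed.

(** Otherwise all [q ^ 2] elements would be roots of ['X^q - 'X], of degree [q]. *)
Lemma theta_neq_id : exists l, theta l != l.
Proof.
apply/existsP; rewrite -negb_forall; apply/negP => /forallP fix_all.
pose p : {poly F} := 'X^q - 'X.
have szp : size p = q.+1.
  by rewrite size_polyDl size_polyXn // size_polyN size_polyX ltnS q_gt1.
have : (#|[set: F]| < size p)%N.
  apply: card_roots_leq; first by rewrite -size_poly_gt0 szp.
  by move=> x _; rewrite rootE !hornerE -thetaE (eqP (fix_all x)) subrr.
by rewrite szp cardsT cardF ltnS leqNgt -mulnn ltn_Pmull ?q_gt1 ?(ltnW q_gt1).
Qed.

Lemma card_selfadjE n : #|selfadj n| = (q ^ (n ^ 2))%N.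
Proof.
have [l nl] := theta_neq_id; apply/eqP.
by rewrite -(@eqn_exp2r _ _ 2) // (card_selfadj theta_inv _ nl) cardF -!expnM mulnC.
Qed.

Lemma selfadj1E (a : F) : (a%:M \in selfadj 1) = (theta a == a).
Proof.
rewrite inE; apply/eqP/eqP => [/matrixP /(_ 0 0)|e].
  by rewrite !mxE eqxx !mulr1n.
by apply/matrixP => i j; rewrite !ord1 !mxE eqxx !mulr1n.
Qed.

(** Fixed elements are the self-adjoint matrices of size [1]. *)
Lemma card_fixed : #|[set a | theta a == a]| = q.
Proof.
have := card_selfadjE 1; rewrite expn1 => <-.
have inj : injective (fun a : F => a%:M : 'M_1).
  by move=> a b /matrixP /(_ 0 0); rewrite !mxE eqxx !mulr1n.
rewrite -(card_imset _ inj); apply: eq_card => A.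
apply/imsetP/idP => [[a + ->]|]; first by rewrite inE selfadj1E.
by rewrite [A]mx11_scalar selfadj1E => fixA; exists (A 0 0); rewrite ?inE.
Qed.

Lemma normM_fixed a : theta (a * theta a) = a * theta a.
Proof. by rewrite rmorphM theta_inv mulrC. Qed.

(** Pigeonhole: a norm [b] is taken at most [q + 1] times, by roots of ['X^(q.+1) - b]. If [c] were
    missed, the [q ^ 2 - 1] nonzero elements would share [q - 2] norms, which leaves room for only
    [(q - 2) * (q + 1)] of them. *)
Lemma norm_surj c : theta c = c -> exists a, a * theta a = c.
Proof.
move=> fix_c; have [->|nz_c] := eqVneq c 0; first by exists 0; rewrite mul0r.
apply/exists_eqP; apply: contraT => /existsPn no_c.
pose E := [set a | theta a == a] :\ 0 :\ c.
have cardE : #|E| = (q - 2)%N.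
  have := cardsD1 0 [set a | theta a == a].
  have := cardsD1 c ([set a | theta a == a] :\ 0).
  rewrite card_fixed !inE nz_c fix_c rmorph0 !eqxx -/E /=.
  by move=> -> ->; rewrite !add1n subn2.
have : (#|[set~ 0%R : F]| <= #|E| * q.+1)%N.
  rewrite -sum1_card (partition_big (fun a => a * theta a) (mem E)) /=.
    rewrite -sum_nat_const leq_sum // => b _.
    pose p : {poly F} := 'X^(q.+1) - b%:P.
    have szp : size p = q.+2 by rewrite size_XnsubC.
    have : (#|[set a : F | (a != 0)%R && (a * theta a == b)%R]| < size p)%N.
      apply: card_roots_leq; first by rewrite -size_poly_gt0 szp.
      move=> a; rewrite inE thetaE rootE !hornerE -exprS => /andP [_ /eqP->].
      by rewrite subrr.
    rewrite szp.
    rewrite ltnS; apply: leq_trans; rewrite -sum1_card.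
    by apply/eq_leq/eq_bigl => a; rewrite !inE.
  move=> a; rewrite !inE => nz_a.
  by rewrite no_c mulf_neq0 ?fmorph_eq0 //= normM_fixed.
rewrite cardsC1 cardF cardE -mulnn; have := q_gt1; nia.
Qed.

(* Polarization: if [u H u^* = 0] for all [u], then expanding at [u + a v] for
   all [a] forces [u H v^* = 0], because [theta] is not the identity. *)
Lemma exists_anisotropic n (H : 'M_n) : H \in selfadj n -> H != 0 ->
  exists v : 'rV_n, v *m H *m star v != 0.
Proof.
move=> /selfadjP sH nzH.
have [//|iso] := pselect (exists v : 'rV_n, v *m H *m star v != 0).
have {}iso (v : 'rV_n) : v *m H *m star v = 0.
  by apply/eqP; apply: contraT => nz; case: iso; exists v.
have [l nl] := theta_neq_id.
have uHv (u v : 'rV_n) : u *m H *m star v = 0.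
  set T := u *m H *m star v.
  have sT : v *m H *m star u = star T.
    by rewrite /T !starM (starK theta_inv) sH mulmxA.
  have polar a : theta a *: T + a *: star T = 0.
    have := iso (u + a *: v).
    rewrite starD starZ !mulmxDr !mulmxDl iso add0r -!scalemxAr -!scalemxAl iso.
    by rewrite !scaler0 addr0 sT addrC.
  have := polar 1; rewrite rmorph1 !scale1r => /eqP; rewrite addrC addr_eq0 => /eqP T1.
  have := polar l; rewrite T1 scalerN -scalerBl => /eqP.
  by rewrite scaler_eq0 subr_eq0 (negPf nl) => /eqP.
case/eqP: nzH; apply/matrixP => i j.
have := uHv (delta_mx 0 i) (star (delta_mx j 0)).
rewrite (starK theta_inv) -rowE -colE => /matrixP /(_ 0 0).
by rewrite !mxE.
Qed.

Lemma exists_unit_vector n (H : 'M_n) : H \in selfadj n -> H != 0 ->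
  exists v : 'rV_n, v *m H *m star v = 1%:M.
Proof.
move=> sH nzH; have [v] := exists_anisotropic sH nzH.
have := selfadj_congr theta_inv v sH.
rewrite [v *m _ *m _]mx11_scalar; set c := _ 0 0; rewrite selfadj1E => /eqP fix_c.
move=> nz_c0; have nz_c : c != 0.
  by apply: contraNneq nz_c0 => ->; rewrite raddf0.
have [a ac] : exists a, a * theta a = c^-1 by apply: norm_surj; rewrite fmorphV fix_c.
exists (a *: v); rewrite starZ -scalemxAr -!scalemxAl [v *m _ *m _]mx11_scalar -/c.
by rewrite scalerA -scalemx1 scalerA [theta a * a]mulrC ac mulVf // scale1r.
Qed.

Lemma row_free_unitmx n (A : 'M[F]_n) :
  (forall u : 'rV_n, u *m A = 0 -> u = 0) -> A \in unitmx.
Proof.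
move=> inj; rewrite -row_free_unit -kermx_eq0; apply/rowV0P => u /sub_kermxP.
exact: inj.
Qed.

Lemma rank_basis m n (A : 'M[F]_(m, n)) k : \rank A = k ->
  exists2 B : 'M_(k, n), row_free B & (B :=: A)%MS.
Proof. by move<-; exists (row_base A); rewrite ?row_base_free //; apply: eq_row_base. Qed.

(** Gram-Schmidt: a unit vector [v] for [H] is split off, its orthogonal complement is the kernel of
    [H *m star v], and in the adapted basis [C] the form is block diagonal with blocks [1] and [H'].
    So every nondegenerate form is equivalent to the standard one. *)
Theorem selfadj_unit_mulstar n (H : 'M_n) : H \in selfadj_unit n ->
  exists2 P : 'M_n, P \in unitmx & H = P *m star P.
Proof.
elim: n H => [|n IHn] H; rewrite inE => /andP [sH uH].
  by exists 1%:M; rewrite ?unitmx1 // [H]flatmx0 [RHS]flatmx0.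
have nzH : H != 0 by apply: contraTneq uH => ->; rewrite unitmxE det0 unitr0.
have [v Hv] := exists_unit_vector sH nzH.
pose w := H *m star v.
have rk_w : \rank (kermx w) = n.
  rewrite mxrank_ker; suff -> : \rank w = 1%N by rewrite subn1.
  apply/eqP; rewrite eqn_leq rank_leq_col lt0n mxrank_eq0.
  by apply: contra_eq_neq Hv; rewrite -mulmxA -/w => ->; rewrite mulmx0 eq_sym oner_neq0.
have [B freeB /eqmxP/andP [/sub_kermxP Bw _]] := rank_basis rk_w.
pose C : 'M_(1 + n, n.+1) := col_mx v B.
have uC : C \in unitmx.
  apply: row_free_unitmx => u; rewrite -[u](@hsubmxK _ _ 1 n) mul_row_col => e.
  have u0 : lsubmx u = 0.
    (* Multiplying by [w] kills the rows of [B] and reads off the coefficient of [v]. *)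
    have := congr1 (mulmx^~ w) e; rewrite /= mulmxDl -!mulmxA Bw mulmx0 addr0 mul0mx.
    by rewrite {1}/w [v *m _]mulmxA Hv mulmx1.
  move: e; rewrite u0 mul0mx add0r => /eqP; rewrite mulmx_free_eq0 // => /eqP->.
  by rewrite row_mx0.
pose H' := B *m H *m star B.
have defH' : C *m H *m star C = block_mx 1%:M 0 0 H'.
  rewrite star_col mul_col_mx mul_col_row Hv -[B *m H *m star v]mulmxA Bw.
  congr block_mx.
  have -> : v *m H *m star B = star (B *m w).
    by rewrite /w !starM (starK theta_inv) (selfadjP _ _ sH).
  by rewrite Bw star0.
have [|P uP defP] := IHn H'.
  rewrite inE selfadj_congr //=.
  have : C *m H *m star C \in unitmx by rewrite !unitmx_mul star_unitmx uC uH.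
  by rewrite defH' !unitmxE det_ublock det1 mul1r.
pose D : 'M_(1 + n) := block_mx 1%:M 0 0 P.
have uD : D \in unitmx by rewrite unitmxE det_ublock det1 mul1r -unitmxE.
exists (invmx C *m D); first by rewrite unitmx_mul unitmx_inv uC.
have DD : D *m star D = block_mx 1%:M 0 0 H'.
  rewrite star_block mulmx_block !star0 star1 !mulmx0 !mul0mx !mulmx1 !addr0 add0r.
  by rewrite -defP.
rewrite starM mulmxA -[_ *m D *m _]mulmxA DD -defH' !mulmxA mulVmx // mul1mx.
by rewrite -mulmxA -starM mulVmx // star1 mulmx1.
Qed.

(** The map sending [P] to [P *m star P] is onto by equivalence of forms, and its fibre through [P]
    is the left coset of the unitary group by [P]. *)
Lemma card_selfadj_unit_unitary n :
  (#|selfadj_unit n| * #|unitary n| = #|[set A : 'M[F]_n | A \in unitmx]|)%N.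
Proof.
rewrite [RHS](card_fibers (f := fun P => P *m star P) (E := selfadj_unit n)
  (c := #|unitary n|)) //.
  by move=> P; rewrite !inE unitmx_mul star_unitmx !starM (starK theta_inv) eqxx => ->.
move=> _ /selfadj_unit_mulstar [P uP ->].
rewrite -(card_imset (unitary n) (can_inj (mulKmx uP))).
apply: eq_card => A; rewrite !inE; apply/andP/imsetP => [[uA /eqP e]|[u uu ->]].
  exists (invmx P *m A); last by rewrite mulKVmx.
  apply/unitaryP; rewrite starM star_inv mulmxA -[_ *m A *m _]mulmxA e.
  by rewrite mulmxA mulVmx // mul1mx mulmxV // star_unitmx.
rewrite unitmx_mul uP (unitary_unitmx uu); split=> //.
by rewrite starM mulmxA -(mulmxA P) (unitaryP _ _ uu) mulmx1.
Qed.

(** The kernel and the image of a self-adjoint idempotent are orthogonal complements, so orthonormal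
    bases of the two together form a unitary matrix. *)
Lemma projection_unitary k m (e : 'M_(k + m)) :
  e \in selfadj (k + m) -> e *m e = e -> \rank e = m ->
  exists2 g, g \in unitary (k + m) & g *m e = block_mx 0 0 0 1%:M *m g.
Proof.
move=> /selfadjP se ee rk_e.
have rk_ker : \rank (kermx e) = k by rewrite mxrank_ker rk_e addnK.
have [B0 free0 /eqmxP/andP [/sub_kermxP B0e _]] := rank_basis rk_ker.
have [B1 free1 /eqmxP/andP [/submxP [D defB1] _]] := rank_basis rk_e.
have B1e : B1 *m e = B1 by rewrite defB1 -mulmxA ee.
have B01 : B0 *m star B1 = 0.
  by rewrite -B1e starM se mulmxA B0e mul0mx.
have B10 : B1 *m star B0 = 0.
  by rewrite -[LHS](starK theta_inv) starM (starK theta_inv) B01 star0.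
pose C := col_mx B0 B1.
have uC : C \in unitmx.
  apply: row_free_unitmx => u; rewrite -[u]hsubmxK mul_row_col => eC.
  have u1 : rsubmx u = 0.
    have := congr1 (mulmx^~ e) eC.
    rewrite /= mulmxDl -!mulmxA B0e B1e mulmx0 add0r mul0mx => /eqP.
    by rewrite mulmx_free_eq0 // => /eqP.
  move: eC; rewrite u1 mul0mx addr0 => /eqP; rewrite mulmx_free_eq0 // => /eqP->.
  by rewrite row_mx0.
have CC : C *m star C = block_mx (B0 *m star B0) 0 0 (B1 *m star B1).
  by rewrite star_col mul_col_row B01 B10.
have : C *m star C \in unitmx by rewrite unitmx_mul star_unitmx uC.
rewrite CC unitmxE det_ublock unitrM -!unitmxE => /andP [u0 u1].
have [|P0 uP0 defP0] := @selfadj_unit_mulstar _ (B0 *m star B0).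
  by rewrite inE u0 selfadj_mulstar.
have [|P1 uP1 defP1] := @selfadj_unit_mulstar _ (B1 *m star B1).
  by rewrite inE u1 selfadj_mulstar.
(* [P0] and [P1] factor the Gram matrices of the two bases, so their inverses orthonormalize these
   bases. *)
pose Q := block_mx (invmx P0) 0 0 (invmx P1).
exists (Q *m C).
  apply/unitaryP; rewrite starM mulmxA -[Q *m C *m _]mulmxA CC defP0 defP1.
  rewrite star_block !mulmx_block !star0 !(mulmx0, mul0mx, addr0, add0r).
  rewrite !star_inv !mulKmx // !mulmxV ?star_unitmx //.
  by rewrite -scalar_mx_block.
have Ce : C *m e = col_mx 0 B1 by rewrite mul_col_mx B0e B1e.
rewrite -[Q *m C *m e]mulmxA Ce.
rewrite !mul_block_col.
by rewrite !(mulmx0, mul0mx, addr0, add0r, mul1mx).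
Qed.

(** [star v *m v] is the orthogonal projection onto the line of [v]; diagonalizing it gives a
    unitary [g] whose last row lies on that line. *)
Lemma unit_vector_completion n (v : 'rV_(n + 1)) : v \in unit_vectors (n + 1) ->
  exists2 A, A \in unitary (n + 1) & dsubmx A = v.
Proof.
rewrite inE => /eqP vv; pose e := star v *m v.
have se : e \in selfadj (n + 1).
  by apply/selfadjP; rewrite starM (starK theta_inv).
have ee : e *m e = e by rewrite /e mulmxA -[_ *m v *m _]mulmxA vv mulmx1.
have nzv : v != 0.
  by apply: contra_eq_neq vv => ->; rewrite mul0mx eq_sym oner_neq0.
have rk_e : \rank e = 1%N.
  apply/eqP; rewrite eqn_leq (leq_trans (mxrankM_maxr _ _)) ?rank_leq_row //.
  rewrite lt0n mxrank_eq0; apply: contra_neq nzv => e0.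
  by rewrite -[v]mul1mx -vv -mulmxA -/e e0 mulmx0.
have [g ug ge] := projection_unitary se ee rk_e.
pose w := dsubmx g.
have we : w *m e = w.
  have := congr1 dsubmx ge.
  by rewrite -[g]vsubmxK mul_col_mx mul_block_col !col_mxKd mul0mx add0r mul1mx.
have ww : w *m star w = 1%:M.
  have := unitaryP _ _ ug; rewrite -[g]vsubmxK star_col mul_col_row scalar_mx_block.
  by case/eq_block_mx.
pose z := w *m star v.
have wzv : w = z *m v by rewrite -mulmxA we.
have zz : z *m star z = 1%:M.
  by rewrite starM (starK theta_inv) mulmxA -[z *m v]mulmxA we ww.
have zz' := mulmx1C zz.
(* The last row of [g] is [z *m v] with [z] of norm one; multiplying it by [star z] gives [v]
   itself. *)
pose Z : 'M_(n + 1) := block_mx 1%:M 0 0 (star z).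
exists (Z *m g); last first.
  rewrite -[g]vsubmxK mul_block_col col_mxKd mul0mx add0r -/w wzv mulmxA zz'.
  by rewrite mul1mx.
apply: unitaryM => //; apply/unitaryP; rewrite star_block mulmx_block.
rewrite !star0 star1 (starK theta_inv) !(mulmx0, mul0mx, addr0, add0r, mul1mx) zz'.
by rewrite -scalar_mx_block.
Qed.

(** Unitary matrices are sorted by their last row. If two of them share it, their quotient has the
    last basis vector as last row, and orthogonality of the rows makes it block diagonal. *)
Lemma card_unitary_add1 n :
  #|unitary (n + 1)| = (#|unit_vectors (n + 1)| * #|unitary n|)%N.
Proof.
have dsub_unit A : A \in unitary (n + 1) -> dsubmx A \in unit_vectors (n + 1).
  move=> /unitaryP; rewrite -{1 2}[A]vsubmxK star_col mul_col_row scalar_mx_block.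
  by case/eq_block_mx => _ _ _ e; rewrite inE e.
apply: (card_fibers dsub_unit) => _ /unit_vector_completion [A0 uA0 <-].
pose f (B : 'M_n) : 'M_(n + 1) := block_mx B 0 0 1%:M *m A0.
have f_inj : injective f.
  move=> B B' /(congr1 (mulmx^~ (star A0))); rewrite /= -!mulmxA (unitaryP _ _ uA0).
  by rewrite !mulmx1 => /eq_block_mx [].
rewrite -(card_imset _ f_inj); apply: eq_card => A; rewrite inE.
apply/andP/imsetP => [[uA /eqP dA]|[B uB ->]].
  pose Z := A *m star A0.
  have uZ : Z \in unitary (n + 1) by rewrite unitaryM ?unitary_star.
  have AZ : A = Z *m A0 by rewrite -mulmxA unitaryK // mulmx1.
  have dZ : dsubmx Z = row_mx 0 1%:M.
    rewrite -mul_dsub_mx dA mul_dsub_mx (unitaryP _ _ uA0) scalar_mx_block.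
    by rewrite block_mxEv col_mxKd.
  move: (unitaryP _ _ uZ); rewrite -{1 2}[Z]submxK.
  have -> : dlsubmx Z = 0 by rewrite /dlsubmx dZ row_mxKl.
  have dr : drsubmx Z = 1%:M by rewrite /drsubmx dZ row_mxKr.
  rewrite dr star_block mulmx_block star0 star1 scalar_mx_block.
  rewrite !(mulmx0, mul0mx, addr0, add0r, mulmx1, mul1mx) => /eq_block_mx [] + ur _ _.
  rewrite ur mul0mx addr0 => uB.
  exists (ulsubmx Z); first by apply/unitaryP.
  by rewrite /f AZ -[Z in LHS]submxK ur dr /dlsubmx dZ row_mxKl.
split; last by rewrite /f -{1}[A0]vsubmxK mul_block_col col_mxKd mul0mx add0r mul1mx.
apply: unitaryM => //; apply/unitaryP; rewrite star_block mulmx_block.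
rewrite !star0 star1 !(mulmx0, mul0mx, addr0, add0r, mul1mx) (unitaryP _ _ uB).
by rewrite -scalar_mx_block.
Qed.

(** * Counting unit vectors *)

Definition norm_sphere n c := [set v : 'rV[F]_n | v *m star v == c%:M].

Lemma card_norm_sphere n c : theta c = c -> c != 0 ->
  #|norm_sphere n c| = #|unit_vectors n|.
Proof.
move=> fix_c nz_c; have [a ac] := norm_surj fix_c.
have nz_a : a != 0 by apply: contra_neq nz_c => a0; rewrite -ac a0 mul0r.
rewrite -(card_imset (unit_vectors n) (scalerI nz_a)); apply: eq_card => v.
apply/idP/imsetP => [|[w + ->]]; rewrite !inE => /eqP e.
  exists (a^-1 *: v); last by rewrite scalerA divff // scale1r.
  rewrite inE starZ -scalemxAr -scalemxAl e !scale_scalar_mx fmorphV.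
  by rewrite mulrA -invfM mulrC [theta a * a]mulrC ac divff.
by rewrite starZ -scalemxAr -scalemxAl e scalerA mulrC ac scale_scalar_mx mulr1.
Qed.

(** Vectors are sorted by norm. Norms lie in the fixed field, and the [q - 1] nonzero ones are
    equally frequent by scaling. *)
Lemma card_norm_sphere_total n :
  (#|norm_sphere n 0| + (q - 1) * #|unit_vectors n| = q ^ (2 * n))%N.
Proof.
have -> : (q ^ (2 * n) = #|[set: 'rV[F]_n]|)%N.
  by rewrite cardsT card_mx cardF mul1n expnM.
rewrite -[RHS]sum1_card.
rewrite (partition_big (fun v : 'rV_n => (v *m star v) 0 0)
  (mem [set a | theta a == a])) /=; last first.
  move=> v _; have := selfadj_mulstar theta_inv v.
  by rewrite {1}[v *m _]mx11_scalar selfadj1E inE.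
have cardE c : (\sum_(v in [set: 'rV[F]_n] | (v *m star v) 0%R 0%R == c) 1 =
    #|norm_sphere n c|)%N.
  rewrite -sum1_card; apply: eq_bigl => v; rewrite !inE /=.
  apply/eqP/eqP => [<-|->]; first by rewrite -mx11_scalar.
  by rewrite !mxE eqxx mulr1n.
rewrite (bigD1 0) /=; last by rewrite inE rmorph0.
rewrite cardE; congr (_ + _)%N.
rewrite (eq_bigr (fun=> #|unit_vectors n|)); last first.
  by move=> c; rewrite inE => /andP [/eqP fc nc]; rewrite cardE card_norm_sphere.
have cardD : #|[set a | theta a == a] :\ 0| = (q - 1)%N.
  have := cardsD1 0 [set a | theta a == a].
  by rewrite card_fixed inE rmorph0 eqxx => ->; rewrite add1n subn1.
rewrite sum_nat_const -cardD; apply: (congr1 (muln^~ _)).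
by apply: eq_card => c; rewrite in_setD1 andbC.
Qed.

(** Isotropic vectors are sorted by their first coordinate [a], the rest having norm
    [- a * theta a], which is nonzero for the [q ^ 2 - 1] nonzero [a]. *)
Lemma card_norm_sphere_add1 n :
  #|norm_sphere (1 + n) 0| = (#|norm_sphere n 0| + (q ^ 2 - 1) * #|unit_vectors n|)%N.
Proof.
rewrite -sum1_card (partition_big (fun v : 'rV_(1 + n) => v 0 0) predT) //=.
have cardE a : (\sum_(v in norm_sphere (1 + n) 0 | v 0%R 0%R == a) 1 =
    #|norm_sphere n (- (a * theta a))|)%N.
  have inj : injective (row_mx (a%:M : 'M_1) : 'rV_n -> 'rV_(1 + n)).
    by move=> u v /eq_row_mx [].
  rewrite sum1_card -(card_imset _ inj); apply: eq_card => v.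
  have v00 : (v 0 0)%:M = lsubmx v :> 'M_1.
    by rewrite [RHS]mx11_scalar mxE; congr (v _ _)%:M; apply: val_inj.
  apply/andP/imsetP => [[+ /eqP va]|[u + ->]]; rewrite ?inE.
    rewrite -{1 2}[v]hsubmxK -v00 va star_row mul_row_col /star tr_scalar_mx.
    rewrite map_scalar_mx -scalar_mxM raddf0 addrC addr_eq0 -raddfN => /eqP e.
    by exists (rsubmx v); rewrite ?inE ?e // -va v00 hsubmxK.
  move=> /eqP e; rewrite star_row mul_row_col e /star tr_scalar_mx.
  rewrite map_scalar_mx -scalar_mxM raddfN subrr raddf0; split=> //.
  have -> : (0 : 'I_(1 + n)) = lshift n 0 by apply: val_inj.
  by rewrite row_mxEl mxE eqxx mulr1n.
rewrite (eq_bigr _ (fun a _ => cardE a)) (bigD1 0) //= mul0r oppr0; congr (_ + _)%N.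
rewrite (eq_bigr (fun=> #|unit_vectors n|)); last first.
  move=> a nz_a; rewrite card_norm_sphere ?rmorphN ?normM_fixed //.
  by rewrite oppr_eq0 mulf_neq0 ?fmorph_eq0.
by rewrite sum_nat_const cardC1 cardF subn1.
Qed.

(** Eliminating the isotropic vectors from the two preceding counts leaves a recursion between the
    numbers of unit vectors in dimensions [n] and [n + 1]. The factor [q] avoids the exponent
    [n - 1]. *)
Lemma card_unit_vectors n :
  #|unit_vectors n|%:R * q%:R = q%:R ^+ n * (q%:R ^+ n - (-1) ^+ n) :> rat.
Proof.
elim: n => [|n IHn].
  rewrite !expr0 subrr mulr0; have -> : unit_vectors 0 = set0.
    apply/setP => v; rewrite !inE [v]thinmx0 mul0mx eq_sym oner_eq0 //.
  by rewrite cards0 mul0r.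
have tot m : #|norm_sphere m 0|%:R + (q%:R - 1) * #|unit_vectors m|%:R =
    q%:R ^+ (2 * m) :> rat.
  have := congr1 (fun x => x%:R : rat) (card_norm_sphere_total m).
  by rewrite natrD natrM natrB ?(ltnW q_gt1) // natrX.
have := congr1 (fun x => x%:R : rat) (card_norm_sphere_add1 n).
rewrite /= natrD natrM natrB ?expn_gt0 ?(ltnW q_gt1) // natrX => e.
have := tot n; have := tot n.+1; rewrite [norm_sphere n.+1 0]/(norm_sphere (1 + n) 0) e.
have q1 : (q%:R - 1 : rat) != 0.
  by rewrite subr_eq0 pnatr_eq1 neq_ltn q_gt1 orbT.
move: IHn; set u := _%:R; set u' := #|unit_vectors n.+1|%:R; set Q : rat := q%:R in q1 *.
move=> IH e1 e2; apply: (mulfI q1).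
have {e2} -> : (Q - 1) * (u' * Q) = Q * (Q ^+ (2 * n) * (Q ^+ 2 - 1) - (Q - 1) * (u * Q)).
  rewrite -e2; move: e1; rewrite mulnS exprD -e2 => e1.
  have -> : (Q - 1) * (u' * Q) = Q * ((Q - 1) * u') by ring.
  congr (Q * _); lra.
rewrite IH mulnC exprM !exprS; ring.
Qed.

(** * Fitting decomposition *)

Definition diag2 k m (A : 'M[F]_k) (B : 'M[F]_m) : 'M_(k + m) := block_mx A 0 0 B.

Lemma diag2M k m (A A' : 'M_k) (B B' : 'M_m) :
  diag2 A B *m diag2 A' B' = diag2 (A *m A') (B *m B').
Proof. by rewrite /diag2 mulmx_block !(mulmx0, mul0mx, addr0, add0r). Qed.
Lemma diag2X k m (A : 'M_k) (B : 'M_m) j : diag2 A B ^+ j = diag2 (A ^+ j) (B ^+ j).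
Proof.
elim: j => [|j IHj]; first by rewrite !expr0 [LHS]scalar_mx_block.
by rewrite !exprS IHj [LHS]diag2M.
Qed.
Lemma star_diag2 k m (A : 'M_k) (B : 'M_m) : star (diag2 A B) = diag2 (star A) (star B).
Proof. by rewrite /diag2 star_block !star0. Qed.
Lemma diag2_inj k m (A A' : 'M_k) (B B' : 'M_m) :
  diag2 A B = diag2 A' B' -> A = A' /\ B = B'.
Proof. by case/eq_block_mx. Qed.

Lemma diag2_commP k m (u : 'M_(k + m)) : u *m diag2 0 1%:M = diag2 0 1%:M *m u ->
  u = diag2 (ulsubmx u) (drsubmx u).
Proof.
rewrite -{1 2}[u]submxK /diag2 !mulmx_block.
rewrite !(mulmx0, mul0mx, addr0, add0r, mulmx1, mul1mx) => /eq_block_mx [_ ur dl _].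
by rewrite -{1}[u]submxK ur -dl.
Qed.

Lemma diag2_unitary k m (A : 'M_k) (B : 'M_m) :
  (diag2 A B \in unitary (k + m)) = (A \in unitary k) && (B \in unitary m).
Proof.
rewrite !inE star_diag2 diag2M scalar_mx_block.
by apply/eqP/andP => [/diag2_inj [-> ->]|[/eqP-> /eqP->]].
Qed.

Lemma conj_unitaryX n (g X : 'M_n) j : g \in unitary n ->
  (g *m X *m star g) ^+ j = g *m X ^+ j *m star g.
Proof.
move=> ug; elim: j => [|j IHj]; first by rewrite !expr0 mulmx1 (unitaryP _ _ ug).
by rewrite !exprS IHj -!mulmxE !mulmxA -[_ *m star g *m g]mulmxA unitaryK // mulmx1.
Qed.

Lemma idem_unitmx n (e : 'M[F]_n) : e \in unitmx -> e *m e = e -> e = 1%:M.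
Proof. by move=> ue ee; rewrite -(mulKmx ue e) ee mulVmx. Qed.

Lemma unitmxX n (A : 'M[F]_n) j : A \in unitmx -> A ^+ j \in unitmx.
Proof.
move=> uA; elim: j => [|j IHj]; first exact: unitmx1.
by rewrite exprS unitmx_mul uA.
Qed.

Local Notation N n := (idem_exp F n).

(* The idempotent power is the projection on the Fitting-one component. *)
Lemma fitting_diag2 k m (A : 'M_k) (B : 'M_m) :
  (diag2 A B ^+ N (k + m) == diag2 0 1%:M) = (A ^+ N k == 0) && (B \in unitmx).
Proof.
have N_gt0 : (0 < N (k + m))%N by rewrite fact_gt0.
rewrite diag2X; apply/eqP/andP => [/diag2_inj [A0 B1]|[A0 uB]].
  split; first by apply/nilpotentP; exists (N (k + m)).
  by move: B1; rewrite -(prednK N_gt0) exprS => /mulmx1_unit [].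
have le_N : (N k <= N (k + m))%N.
  rewrite /idem_exp leq_fact // !card_mx leq_exp2l ?finNzRing_gt1 //.
  by rewrite leq_mul ?leq_addr.
congr diag2; first by rewrite -(subnK le_N) exprD (eqP A0) mulr0.
apply: idem_unitmx; first exact: unitmxX.
have := idem_expP (diag2 A B); rewrite diag2X -mulmxE diag2M.
by case/diag2_inj.
Qed.

(** The rank of the idempotent power is the dimension of the invertible Fitting component; the
    nilpotent one has dimension [k]. *)
Definition fitting_type k m :=
  [set X in selfadj (k + m) | \rank (X ^+ N (k + m)) == m].

Lemma rank_diag2_01 k m : \rank (diag2 (0 : 'M[F]_k) (1%:M : 'M_m)) = m.
Proof. by rewrite /diag2 rank_diag_block_mx mxrank0 mxrank1. Qed.

Lemma conj_unitary_eq n (g X Y : 'M_n) : g \in unitary n ->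
  (star g *m X *m g == Y) = (X == g *m Y *m star g).
Proof.
move=> ug; apply/eqP/eqP => [<-|->].
  by rewrite !mulmxA (unitaryP _ _ ug) mul1mx -mulmxA (unitaryP _ _ ug) mulmx1.
by rewrite !mulmxA (unitaryK ug) mul1mx -mulmxA (unitaryK ug) mulmx1.
Qed.

Lemma rank_conj_unitary n (g X : 'M_n) : g \in unitary n ->
  \rank (g *m X *m star g) = \rank X.
Proof.
move=> ug; rewrite mxrankMfree ?row_free_unit ?star_unitmx ?(unitary_unitmx ug) //.
by rewrite (eqmxMfull X) // row_full_unit (unitary_unitmx ug).
Qed.

(** The idempotent power of [X] is an orthogonal projection, which a unitary [g] makes diagonal. The
    conjugate of [X] by [g] commutes with its own power, hence is block diagonal. *)
Lemma fitting_decomposition k m X : X \in fitting_type k m ->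
  exists2 x : 'M_(k + m) * 'M_k * 'M_m,
    x \in setX (setX (unitary (k + m)) (selfadj_nil k)) (selfadj_unit m)
    & star x.1.1 *m diag2 x.1.2 x.2 *m x.1.1 = X.
Proof.
rewrite inE => /andP [/selfadjP sX /eqP rkX].
have sXN : X ^+ N (k + m) \in selfadj (k + m) by apply/selfadjP; rewrite starX sX.
have [g ug gX] := projection_unitary sXN (idem_expP X) rkX.
pose Z := g *m X *m star g.
have ZN : Z ^+ N (k + m) = diag2 0 1%:M.
  by rewrite conj_unitaryX // gX -mulmxA (unitaryP _ _ ug) mulmx1.
have defZ : Z = diag2 (ulsubmx Z) (drsubmx Z).
  by apply: diag2_commP; rewrite -ZN !mulmxE -exprSr -exprS.
have sZ : Z \in selfadj (k + m) by apply: selfadj_congr => //; apply/selfadjP.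
have [sZ0 sZ1] : star (ulsubmx Z) = ulsubmx Z /\ star (drsubmx Z) = drsubmx Z.
  by apply: diag2_inj; rewrite -star_diag2 -defZ; apply/selfadjP.
have : Z ^+ N (k + m) == diag2 0 1%:M by rewrite ZN.
rewrite defZ fitting_diag2 => /andP [nZ0 uZ1].
exists (g, ulsubmx Z, drsubmx Z).
  by rewrite !inE /= (unitaryP _ _ ug) sZ0 sZ1 !eqxx nZ0 uZ1.
by rewrite /= -defZ; apply/eqP; rewrite conj_unitary_eq.
Qed.

(** Double counting of triples of a unitary frame, a nilpotent block and an invertible block: those
    giving the same matrix differ by a unitary change of basis in each block. *)
Lemma card_fitting_type k m :
  (#|fitting_type k m| * (#|unitary k| * #|unitary m|) =
   #|unitary (k + m)| * #|selfadj_nil k| * #|selfadj_unit m|)%N.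
Proof.
rewrite -(cardsX (unitary k)) -(cardsX (unitary (k + m))).
rewrite -(cardsX (setX _ _) (selfadj_unit m)); apply/esym.
pose f (x : 'M_(k + m) * 'M_k * 'M_m) := star x.1.1 *m diag2 x.1.2 x.2 *m x.1.1.
apply: (card_fibers (f := f)) => [[[g X0] X1]|X].
  rewrite !inE /= /f /= => /andP [/andP [/eqP ug /andP [/eqP s0 n0]] /andP [/eqP s1 u1]].
  have {}ug : star g \in unitary (k + m) by apply: unitary_star => //; apply/unitaryP.
  have -> : star g *m diag2 X0 X1 *m g = star g *m diag2 X0 X1 *m star (star g).
    by rewrite (starK theta_inv).
  rewrite conj_unitaryX // rank_conj_unitary //.
  have -> : diag2 X0 X1 ^+ N (k + m) = diag2 0 1%:M.
    by apply/eqP; rewrite fitting_diag2 n0.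
  by rewrite rank_diag2_01 eqxx andbT !starM !(starK theta_inv) star_diag2 s0 s1 mulmxA.
case/fitting_decomposition => -[[g X0] X1] /setXP [/setXP [/= ug]].
rewrite !inE => /andP [/eqP s0 n0] /andP [/eqP s1 u1] <-.
pose h (y : 'M_k * 'M_m) : 'M_(k + m) * 'M_k * 'M_m :=
  (diag2 y.1 y.2 *m g, y.1 *m X0 *m star y.1, y.2 *m X1 *m star y.2).
have h_inj : injective h.
  move=> [a d] [a' d'] [/(congr1 (mulmx^~ (star g)))] /=.
  by rewrite -!mulmxA (unitaryP _ _ ug) !mulmx1 => /diag2_inj [-> ->].
rewrite -(card_imset _ h_inj); apply: eq_card => -[[g' Y0] Y1]; rewrite inE.
apply/andP/imsetP => [[]|[[a d] /setXP [/= ua ud] [-> -> ->]]].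
  rewrite !inE /= => /andP [/andP [/eqP ug' /andP [/eqP t0 m0]] /andP [/eqP t1 v1]].
  have {}ug' : g' \in unitary (k + m) by apply/unitaryP.
  rewrite /f /= conj_unitary_eq // => /eqP e.
  pose u := g' *m star g.
  have uu : u \in unitary (k + m) by rewrite unitaryM ?unitary_star.
  have {}e : diag2 Y0 Y1 = u *m diag2 X0 X1 *m star u.
    by rewrite e /u starM (starK theta_inv) !mulmxA.
  (* Both block matrices have the same idempotent power, so [u] commutes with it and is block
     diagonal. *)
  have eN : diag2 0 1%:M = u *m diag2 0 1%:M *m star u.
    have dX : diag2 X0 X1 ^+ N (k + m) = diag2 0 1%:M.
      by apply/eqP; rewrite fitting_diag2 n0.
    have dY : diag2 Y0 Y1 ^+ N (k + m) = diag2 0 1%:M.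
      by apply/eqP; rewrite fitting_diag2 m0.
    by rewrite -{2}dX -conj_unitaryX // -e dY.
  have defu : u = diag2 (ulsubmx u) (drsubmx u).
    apply: diag2_commP; rewrite {2}eN -[RHS]mulmxA unitaryK // mulmx1 //.
  move: uu; rewrite defu diag2_unitary => /andP [ua ud].
  move: e; rewrite defu star_diag2 !diag2M => /diag2_inj [-> ->].
  exists (ulsubmx u, drsubmx u); first by rewrite in_setX ua.
  by rewrite /h /= -defu; congr (_, _, _); rewrite /u -mulmxA unitaryK // mulmx1.
have uy : diag2 a d \in unitary (k + m) by rewrite diag2_unitary ua.
split.
  rewrite !in_setX unitaryM //= inE selfadj_congr //; last by apply/selfadjP.
  rewrite inE selfadj_congr //; last by apply/selfadjP.
  rewrite conj_unitaryX // (eqP n0) mulmx0 mul0mx eqxx.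
  by rewrite !unitmx_mul star_unitmx u1 (unitary_unitmx ud).
rewrite /f /= conj_unitary_eq ?unitaryM //; apply/eqP.
rewrite starM !mulmxA -[_ *m g *m star g]mulmxA (unitaryP _ _ ug) mulmx1.
by rewrite -[_ *m g *m star g]mulmxA (unitaryP _ _ ug) mulmx1 star_diag2 !diag2M.
Qed.

(** * Recursions for the orders and induction on the size *)

Section Counting.

Let Q : rat := q%:R.
Let u n : rat := #|unitary n|%:R.
Let a n : rat := #|selfadj_unit n|%:R.
Let s n : rat := #|selfadj_nil n|%:R.
Let g n : rat := #|[set A : 'M[F]_n | A \in unitmx]|%:R.

Let Q_neq0 : Q != 0.
Proof. by rewrite pnatr_eq0 -lt0n ltnW. Qed.

Let sub_neq0 n : Q ^+ n.+1 - (-1) ^+ n.+1 != 0.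
Proof.
rewrite subr_eq0; apply: contraTneq (isT : true) => /(congr1 Num.norm).
rewrite !normrX normrN1 expr1n ger0_norm ?ler0n // => /eqP.
by rewrite pexpr_eq1 ?ler0n // pnatr_eq1 gtn_eqF.
Qed.

Let u_neq0 n : u n != 0.
Proof.
rewrite pnatr_eq0 -lt0n card_gt0; apply/set0Pn; exists 1%:M; exact: unitary1.
Qed.

Let u0 : u 0 = 1.
Proof.
rewrite /u; have -> : unitary 0 = [set 1%:M]; last by rewrite cards1.
by apply/setP => A; rewrite !inE [A]flatmx0 [1%:M]flatmx0 mul0mx !eqxx.
Qed.

Let uS n : u n.+1 = Q ^+ n * (Q ^+ n.+1 - (-1) ^+ n.+1) * u n.
Proof.
rewrite /u -addn1 card_unitary_add1 natrM addn1; congr (_ * _).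
apply: (mulIf Q_neq0); rewrite card_unit_vectors -/Q.
by rewrite exprSr; ring.
Qed.

Let gS n : g n.+1 = Q ^+ (2 * n) * (Q ^+ (2 * n.+1) - 1) * g n.
Proof.
rewrite /g card_unitmxS cardF -!expnM !natrM natrB ?natrX //.
by rewrite expn_gt0 ltnW.
Qed.

Let aE n : a n = g n / u n.
Proof. by rewrite /g -card_selfadj_unit_unitary natrM -/(u n) mulfK. Qed.

(** [al n] is [s n / u n] with the claimed value in place of [s n]. *)
Let al n : rat := Q ^+ (n * n.-1) / u n.
Let be n : rat := a n / u n.
Let t := - Q.

Let tE n : t ^+ n.+1 - 1 = (-1) ^+ n.+1 * (Q ^+ n.+1 - (-1) ^+ n.+1).
Proof. by rewrite mulrBr -expr2 sqrr_sign /t (exprNn Q). Qed.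

Let al_rec k : (t ^+ k.+1 - 1) * al k.+1 = - t ^+ k * al k.
Proof.
rewrite tE /al uS; have := sub_neq0 k; set d := _ - _ => nz_d.
have -> : Q ^+ (k.+1 * k.+1.-1) = Q ^+ k * Q ^+ k * Q ^+ (k * k.-1).
  by rewrite -!exprD; congr (_ ^+ _); case: (k) => [|j] //=; rewrite -?pred_Sn; lia.
rewrite /t (exprNn Q) [(-1) ^+ k.+1]exprS; field.
by rewrite nz_d u_neq0 expf_neq0.
Qed.

Let be_rec m : (t ^+ m.+1 - 1) * be m.+1 = (t ^+ m.+1 + 1) * be m.
Proof.
rewrite tE /be !aE gS uS; have := sub_neq0 m; set d := _ - _ => nz_d.
have -> : Q ^+ (2 * m.+1) - 1 = d * (Q ^+ m.+1 + (-1) ^+ m.+1).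
  by rewrite /d -subr_sqr mulnC exprM sqrr_sign.
have -> : t ^+ m.+1 + 1 = (-1) ^+ m.+1 * (Q ^+ m.+1 + (-1) ^+ m.+1).
  by rewrite mulrDr -expr2 sqrr_sign /t (exprNn Q).
rewrite mulnC exprM; field.
by rewrite nz_d u_neq0 expf_neq0.
Qed.

Let convE n : Q ^+ (n ^ 2) / u n = \sum_(k < n.+1) al k * be (n - k)%N.
Proof.
elim: n => [|n IHn].
  rewrite big_ord1 /al /be aE /g card_unitmx0 u0 !expr0; by field.
have nz : t ^+ n.+1 - 1 != 0 by rewrite tE mulf_neq0 ?signr_eq0.
apply: (mulfI nz); rewrite (convolution_rec _ al_rec be_rec) -IHn tE uS.
have := sub_neq0 n; set d := _ - _ => nz_d.
have -> : Q ^+ (n.+1 ^ 2) = Q ^+ n * Q ^+ n.+1 * Q ^+ (n ^ 2).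
  by rewrite -!exprD; congr (_ ^+ _); lia.
rewrite /t (exprNn Q); field.
by rewrite nz_d u_neq0 expf_neq0.
Qed.

(** The [q ^ (n ^ 2)] self-adjoint matrices are sorted by the dimension [k] of their nilpotent
    Fitting component. *)
Let fittingE n : Q ^+ (n ^ 2) / u n = \sum_(k < n.+1) s k / u k * be (n - k)%N.
Proof.
have fit k m : (k + m = n)%N ->
    #|[set X in selfadj n | \rank (X ^+ idem_exp F n) == m]|%:R / u n =
    s k / u k * be m.
  move=> <-.
  have := congr1 (fun x => x%:R : rat) (card_fitting_type k m).
  rewrite /= !natrM -/(u k) -/(u m) -/(u (k + m)%N) -/(s k) -/(a m) => e.
  rewrite -[[set X in _ | _]]/(fitting_type k m).
  have -> : #|fitting_type k m|%:R = u (k + m)%N * s k * a m / (u k * u m).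
    by rewrite -e mulfK // mulf_neq0.
  rewrite /be; field; by rewrite !u_neq0.
have fitk (k : 'I_n.+1) : (k + (n - k) = n)%N by rewrite subnKC // -ltnS.
rewrite -(eq_bigr _ (fun k _ => fit _ _ (fitk k))) -mulr_suml -natr_sum; congr (_ / _).
rewrite /Q -natrX -card_selfadjE -sum1_card; congr (_%:R).
rewrite (partition_big (fun X : 'M_n =>
  (inord (n - \rank (X ^+ idem_exp F n)) : 'I_n.+1)) predT) //=.
apply: eq_bigr => k _; rewrite -sum1_card; apply: eq_bigl => X; rewrite [RHS]inE.
congr andb; rewrite -val_eqE /= inordK ?ltnS ?leq_subr //.
have := rank_leq_row (X ^+ idem_exp F n); have := ltn_ord k.
by move: (\rank _) (nat_of_ord k) => r j lt_jn le_rn; apply/eqP/eqP; lia.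
Qed.

Theorem card_selfadj_nil n : #|selfadj_nil n| = (q ^ (n * (n - 1)))%N.
Proof.
apply/eqP; rewrite -(eqr_nat rat) natrX subn1 -/(s n) -/Q; apply/eqP.
elim/ltn_ind: n => n IHn; apply: (divIf (u_neq0 n)) => /=.
(* By induction the two convolutions agree in all terms below [n]. Comparing them leaves the terms
   at [n], which carry the factor [be 0]. *)
have be0 : be 0 != 0 by rewrite /be aE /g card_unitmx0 u0 !divr1 oner_neq0.
apply: (mulIf be0); have := fittingE n; rewrite convE !big_ord_recr /= subnn.
rewrite (eq_bigr (fun k : 'I_n => s k / u k * be (n - k)%N)); first by move/addrI.
by move=> k _; rewrite /al IHn.
Qed.

End Counting.

(** * Cayley transform *)

Definition unitary_unipotent n :=
  [set A in unitary n | (A - 1%:M) ^+ idem_exp F n == 0].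

(* The Cayley transform [X |-> (1 + l X) (1 + theta l X)^-1] turns nilpotent
   self-adjoint matrices into unipotent unitary ones. *)
Lemma card_unitary_unipotent n : #|unitary_unipotent n| = #|selfadj_nil n|.
Proof.
have [l nl] := theta_neq_id; pose mu := theta l.
have theta_mu : theta mu = l by rewrite /mu theta_inv.
have nz_d : mu - l != 0 by rewrite subr_eq0.
pose P c (X : 'M[F]_n) := 1%:M + c *: X.
have P_unit c X : X ^+ idem_exp F n = 0 -> P c X \in unitmx.
  by apply: nilpotent_unitmx; rewrite oner_neq0.
have P_comm c X Y : X *m Y = Y *m X -> P c X *m Y = Y *m P c X.
  by move=> XY; rewrite mulmxDl mulmxDr mul1mx mulmx1 -scalemxAl -scalemxAr XY.
have P_star c X : star X = X -> star (P c X) = P (theta c) X.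
  by move=> sX; rewrite starD star1 starZ sX.
(* Solving [A *m P mu X = P l X] for [X] gives [D A *m X = 1%:M - A]. Since [D A] is [mu - l] plus a
   multiple of [A - 1%:M], it is invertible for unipotent [A]. *)
pose D A : 'M[F]_n := mu *: A - l%:M.
have D_unit A : (A - 1%:M) ^+ idem_exp F n = 0 -> D A \in unitmx.
  move=> nA; have -> : D A = (mu - l)%:M + mu *: (A - 1%:M).
    by rewrite scalerBr scalemx1 raddfB /= addrC addrA subrK.
  exact: nilpotent_unitmx nA.
have relP A X : A *m P mu X = P l X <-> D A *m X = 1%:M - A.
  rewrite mulmxDr mulmxBl mulmx1 -scalemxAr -scalemxAl mul_scalar_mx.
  split=> [e|/eqP]; first apply/eqP.
    by rewrite subr_eq addrAC -/(P l X) -e addrAC subrr add0r.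
  by rewrite subr_eq addrAC => /eqP->; rewrite [A + _]addrC subrK.
pose f X := P l X *m invmx (P mu X).
have f_rel X : X ^+ idem_exp F n = 0 -> D (f X) *m X = 1%:M - f X.
  by move=> nX; apply/relP; rewrite mulmxKV ?P_unit.
have f_unip X : X ^+ idem_exp F n = 0 -> (f X - 1%:M) ^+ idem_exp F n = 0.
  move=> nX; pose W := invmx (P mu X).
  (* Nilpotency passes from [X] to this product because its factors commute. *)
  have -> : f X - 1%:M = (l - mu)%:M *m X *m W.
    rewrite mul_scalar_mx -(mulmxV (P_unit mu X nX)) -mulmxBl; congr (_ *m _).
    by rewrite scalerBl opprD addrACA subrr add0r.
  have XW : X *m W = W *m X by apply: comm_mx_inv; rewrite P_comm.
  rewrite exprmxM; first by rewrite exprmxM ?scalar_mxC // nX mulmx0 mul0mx.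
  by rewrite -mulmxA XW mulmxA -scalar_mxC -mulmxA.
have f_inj : {in selfadj_nil n &, injective f}.
  move=> X Y; rewrite !inE => /andP [_ /eqP nX] /andP [_ /eqP nY] e.
  have := f_rel X nX; rewrite e -(f_rel Y nY).
  by apply: can_inj (mulKmx _) _ _; apply/D_unit/f_unip.
rewrite -(card_in_imset f_inj); apply: eq_card => A.
apply/idP/imsetP => [|[X + ->]].
  rewrite !inE => /andP [/eqP uA /eqP nA]; have uD := D_unit A nA.
  pose X := invmx (D A) *m (1%:M - A).
  have defX : D A *m X = 1%:M - A by rewrite mulKVmx.
  have nX : X ^+ idem_exp F n = 0.
    have AD : A *m D A = D A *m A.
      by rewrite /D mulmxBl mulmxBr -scalemxAl -scalemxAr scalar_mxC.
    have comm : (1%:M - A) *m D A = D A *m (1%:M - A).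
      by rewrite [LHS]mulmxBl [RHS]mulmxBr mul1mx mulmx1 AD.
    rewrite exprmxM; last by rewrite comm_mx_inv.
    by rewrite -[1%:M - A]opprB exprNn nA mulr0 mulmx0.
  have sX : star X = X.
    have uS : star (D A) \in unitmx by rewrite star_unitmx.
    (* Clearing the inverses in [star X = X] leaves this identity, which holds by
       [A *m star A = 1%:M]. *)
    have cross : D A *m star (1%:M - A) = (1%:M - A) *m star (D A).
      have starS : star (D A) = l *: star A - mu%:M.
        by rewrite starB starZ theta_mu {2}/star tr_scalar_mx map_scalar_mx.
      have DA : D A *m star A = mu%:M - l *: star A.
        by rewrite mulmxBl -scalemxAl uA mul_scalar_mx scalemx1.
      have AS : A *m star (D A) = l%:M - mu *: A.
        by rewrite starS mulmxBr -scalemxAr uA mul_mx_scalar scalemx1.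
      rewrite starB star1 [LHS]mulmxBr [RHS]mulmxBl mulmx1 mul1mx DA AS starS.
      by rewrite !opprB [RHS]addrC.
    rewrite starM star_inv; apply: (canLR (mulmxK uS)).
    by rewrite -mulmxA -cross mulKmx.
  exists X; first by rewrite !inE sX nX !eqxx.
  by apply: (canRL (mulmxK (P_unit mu X nX))); apply/relP.
rewrite !inE => /andP [/eqP sX /eqP nX]; rewrite f_unip // eqxx andbT.
have starf : star (f X) = invmx (P l X) *m P mu X.
  by rewrite /f starM star_inv (P_star mu X sX) (P_star l X sX) theta_mu.
rewrite starf /f comm_mx_inv; last by rewrite (P_comm mu) // -(P_comm l).
by rewrite mulmxA mulmxK ?P_unit // mulVmx // P_unit.
Qed.

End HermitianForms.

(** * Matrix of a Hermitian form *)

Lemma sesquilinear_inj (F : finFieldType) (theta : {rmorphism F -> F}) n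
    (M M' : 'M[F]_n) :
  involutive theta ->
  (forall u v : 'rV_n, u *m M *m star theta v = u *m M' *m star theta v) -> M = M'.
Proof.
move=> theta_inv eqM; apply/matrixP => i j.
have := eqM (delta_mx 0 i) (star theta (delta_mx j 0)).
rewrite (starK theta_inv) -!rowE -!colE => /matrixP /(_ 0 0).
by rewrite !mxE.
Qed.

Lemma conjmxX n (R : comUnitRingType) (P A : 'M[R]_n) k : P \in unitmx ->
  (P *m A *m invmx P) ^+ k = P *m A ^+ k *m invmx P.
Proof.
move=> uP; elim: k => [|k IHk]; first by rewrite !expr0 mulmx1 mulmxV.
by rewrite !exprS IHk -!mulmxE !mulmxA mulmxKV.
Qed.

Section HermitianMatrix.
Variables (F : finFieldType) (theta : {rmorphism F -> F}) (n : nat).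
Variable h : {hermitian 'rV[F]_n for false & theta}.
Hypothesis theta_inv : involutive theta.

Local Notation star := (star theta).
Local Notation H := (matrix_of_form h).

Lemma form_matrixE (u v : 'rV_n) : u *m H *m star v = (h u v)%:M.
Proof.
rewrite -(matrix_of_formK h u v) /form_of_matrix -/(star v).
by rewrite [LHS]mx11_scalar trace_mx11.
Qed.

Lemma matrix_of_form_selfadj : H \in selfadj theta n.
Proof.
apply/selfadjP/matrixP => i j; rewrite !mxE.
by rewrite [RHS]hermC expr0 mul1r.
Qed.

Lemma matrix_of_form_unitmx : nondegenerate h -> H \in unitmx.
Proof.
move=> /eqP hh; apply: row_free_unitmx => u uH.
suff : u \in orthov h fullv by rewrite hh memv0 => /eqP.
apply/mem_orthovP => v _.
have := form_matrixE u v; rewrite uH mul0mx => /matrixP /(_ 0 0).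
by rewrite !mxE eqxx mulr1n.
Qed.

Lemma mem_unitary_group A : H \in unitmx ->
  (A \in unitary_group h) = (A *m H *m star A == H).
Proof.
move=> uH; rewrite inE; apply/andP/eqP => [[_ /asboolP iso]|AHA].
  apply: (sesquilinear_inj theta_inv) => u v.
  rewrite form_matrixE -(iso u v) /= -form_matrixE starM.
  by rewrite !mulmxA.
split.
  by move: uH; rewrite -AHA !unitmx_mul => /andP [/andP []].
apply/asboolP => u v /=.
have := form_matrixE (u *m A) (v *m A).
rewrite starM mulmxA -[u *m A *m H]mulmxA -[u *m _ *m star A]mulmxA AHA form_matrixE.
by move/matrixP/(_ 0 0); rewrite !mxE eqxx !mulr1n.
Qed.

End HermitianMatrix.

Theorem corollary2 (q n : nat) (hq : prime_power q) (hn : (1 <= n)%N)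
    (F : finFieldType) (hF : #|F| = (q ^ 2)%N)
    (K : closedFieldType) (iota : {rmorphism F -> K})
    (hK : integralRange iota)
    (theta : {rmorphism F -> F}) (htheta : forall a : F, theta a = a ^+ q)
    (h : {hermitian 'rV[F]_n for false & theta}) (hh : nondegenerate h) :
  #|[set A in unitary_group h | `[< unipotent iota A >]]|
    = (q ^ (n * (n - 1)))%N.
Proof.
have theta_inv := theta_inv hF htheta.
have uH := matrix_of_form_unitmx hh.
have [|P uP defH] := selfadj_unit_mulstar hF htheta (H := matrix_of_form h).
  by rewrite inE matrix_of_form_selfadj.
have uPs : star theta P \in unitmx by rewrite star_unitmx.
rewrite -(card_selfadj_nil hF htheta) -(card_unitary_unipotent hF htheta).
(* As [P *m star P] is the matrix of [h], conjugation by [P] carries the standard unitary group onto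
   that of [h], and it preserves nilpotency of [B - 1%:M]. *)
pose c (B : 'M[F]_n) := P *m B *m invmx P.
have cK : cancel c (fun A => invmx P *m A *m P).
  by move=> B; rewrite /c !mulmxA mulVmx // mul1mx mulmxKV.
rewrite -[RHS](card_imset _ (can_inj cK)); apply: eq_card => A.
have cKV : c (invmx P *m A *m P) = A by rewrite /c !mulmxA mulmxV // mul1mx mulmxK.
rewrite -[in RHS]cKV (mem_imset _ _ (can_inj cK)) -[in LHS]cKV.
move: (invmx P *m A *m P) => B; rewrite inE mem_unitary_group // defH inE.
congr andb.
  have -> : c B *m (P *m star theta P) *m star theta (c B) =
      P *m (B *m star theta B) *m star theta P.
    by rewrite /c !starM star_inv !mulmxA mulmxKV // mulmxK.
  rewrite inE; apply/eqP/eqP => [/(canRL (mulmxK uPs))|->]; last by rewrite mulmx1.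
  by rewrite mulmxK // => /(canRL (mulKmx uP)); rewrite mulVmx.
transitivity ((c B - 1%:M) ^+ idem_exp F n == 0).
  by apply/asboolP/idP; move/(unipotentP iota _ hn).
have -> : c B - 1%:M = c (B - 1%:M).
  by rewrite /c mulmxBr mulmxBl mulmx1 mulmxV.
rewrite conjmxX //; apply/eqP/eqP => [|->]; last by rewrite mulmx0 mul0mx.
by move=> e; rewrite -[LHS]cK /c e mulmx0 mul0mx.
Qed.
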